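(* Let $n \ge 2$ be an integer. If $n \geq 2$ is even, then \[\mathrm{ParseWords}(\mathrm{LeftCombTree}(n), \mathrm{RightCrookedTree}(n)) = \left\{ \mathrm{mod}(1-n,3)\, \left((012)^{n/6}\right)^R (012)^{(n-2)/6} \right\},\] and if $n \geq 3$ is odd, then \[\mathrm{ParseWords}(\mathrm{LeftCombTree}(n), \mathrm{RightCrookedTree}(n)) = \left\{ \mathrm{mod}(1-n,3)\, \left((012)^{(n-3)/6}\right)^R (012)^{(n+1)/6} \right\}.\] (Sets of equivalence classes are written by listing one representative of each class; juxtaposition is concatenation, the value $\mathrm{mod}(1-n,3)\in\{0,1,2\}$ being a single letter.)
   Context: A binary tree is a rooted ordered tree in which each vertex has either $0$ or $2$ children; its leaves are ordered left to right. Let $G$ be the context-free grammar with start symbols $0,1,2$ and rules $0\to 12$, $0\to 21$, $1\to 02$, $1\to 20$, $2\to 01$, $2\to 10$. An $n$-leaf binary tree $T$ parses a word $w$ of length $n$ on $\{0,1,2\}$ if there is a labeling of the vertices of $T$ by $0,1,2$ such that the leaves, from left to right, are labeled with the letters of $w$, and at every internal vertex the label of the vertex together with the labels of its left and right children form a rule of $G$ (i.e. the three labels are pairwise distinct). If $T$ parses $w$, it also parses every word obtained from $w$ by permuting the alphabet $\{0,1,2\}$. For $n$-leaf binary trees $T_1,T_2$, $\mathrm{ParseWords}(T_1,T_2)$ denotes the set of equivalence classes (under permutations of the alphabet $\{0,1,2\}$) of words parsed by both $T_1$ and $T_2$; it is written by listing one representative of each class. If $w=w_1\cdots w_m$ is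 a word of length $m$ and $x\ge 0$ is a rational number whose denominator in lowest terms divides $m$, then $w^x = w^{\lfloor x\rfloor} w_1 w_2\cdots w_{m(x-\lfloor x\rfloor)}$ is the word of length $mx$ consisting of repeated copies of $w$ truncated at $mx$ letters. $w^R$ is the left–right reversal of $w$. $\mathrm{mod}(a,3)$ is the smallest nonnegative integer congruent to $a$ modulo $3$. The level of a vertex is its distance from the root. A path tree is a binary tree with at most two vertices on each level. For $n\ge 2$, $n$-leaf path trees correspond bijectively to words $x_1\cdots x_{n-2}$ on $\{l,r\}$: $x_j=l$ (resp. $x_j=r$) means that, of the two vertices on level $j$, the left (resp. right) one has children. $\mathrm{LeftCombTree}(n)$ is the $n$-leaf path tree corresponding to $l^{n-2}$. $\mathrm{RightCrookedTree}(n)$ is the $n$-leaf path tree corresponding to $(rl)^{(n-2)/2}$, i.e. the word $rlrl\cdots$ of length $n-2$. *)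

(* Defs.v *)
From mathcomp Require Import all_boot all_order all_fingroup all_algebra.
From mathcomp Require Import boolp classical_sets.

Set Implicit Arguments.
Unset Strict Implicit.
Unset Printing Implicit Defensive.

Import Order.TTheory GRing.Theory Num.Theory.
Local Open Scope ring_scope.
Local Open Scope classical_set_scope.

Inductive btree : Type := Leaf | Node of btree & btree.

Definition lft : bool := false.
Definition rgt : bool := true.

(* A vertex is the sequence of turns leading to it from the root, so that its
   level is the size of that sequence. *)
Fixpoint leaves (T : btree) : seq (seq bool) :=
  if T is Node T1 T2 then
    map (cons lft) (leaves T1) ++ map (cons rgt) (leaves T2)
  else [:: [::]].

Fixpoint internal (T : btree) : seq (seq bool) :=
  if T is Node T1 T2 then
    [::] :: map (cons lft) (internal T1) ++ map (cons rgt) (internal T2)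
  else [::].

(* The triple (a, b, c) stands for the rule a -> bc. *)
Definition grammar : seq ('I_3 * 'I_3 * 'I_3) :=
  [:: (0, 1, 2%:R); (0, 2%:R, 1);
      (1, 0, 2%:R); (1, 2%:R, 0);
      (2%:R, 0, 1); (2%:R, 1, 0)].

Lemma grammarE (a b c : 'I_3) : ((a, b, c) \in grammar) = uniq [:: a; b; c].
Proof.
by case: a b c => [[|[|[|?]]] ?] // [[|[|[|?]]] ?] // [[|[|[|?]]] ?].
Qed.

(* The labeling f is total, but only its values at the vertices of T matter. *)
Definition parses (T : btree) (w : seq 'I_3) : Prop :=
  exists f : seq bool -> 'I_3,
    map f (leaves T) = w /\
    forall v, v \in internal T ->
      (f v, f (rcons v lft), f (rcons v rgt)) \in grammar.

Definition word_class (w : seq 'I_3) : set (seq 'I_3) :=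
  [set u | exists s : {perm 'I_3}, u = map s w].

Definition ParseWords (T1 T2 : btree) : set (set (seq 'I_3)) :=
  [set C | exists w, [/\ parses T1 w, parses T2 w & C = word_class w]].

(* The power w^x, meant for x >= 0 with denominator dividing size w; then
   size w * (x - floor x) is a natural number and truncn returns it exactly. *)
Definition word_pow (A : Type) (w : seq A) (x : rat) : seq A :=
  flatten (nseq (Num.truncn x) w) ++
  take (Num.truncn ((size w)%:R * (x - (Num.truncn x)%:R))) w.

Definition mod3 (a : int) : 'I_3 := inord `|(a %% 3)%Z|%N.

Definition w012 : seq 'I_3 := [:: 0; 1; 2%:R].

Definition path_tree_prop (T : btree) : Prop :=
  forall j, (count (fun v => size v == j) (internal T ++ leaves T) <= 2)%N.

(* The first letter of x selects which child of the root has children. *)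
Fixpoint path_tree (x : seq bool) : btree :=
  match x with
  | [::] => Node Leaf Leaf
  | b :: x' =>
      if b == lft then Node (path_tree x') Leaf else Node Leaf (path_tree x')
  end.

Lemma internal_path_tree x :
  internal (path_tree x) = [seq take j x | j <- iota 0 (size x).+1].
Proof.
elim: x => [|b x IH] //.
have -> : [seq take j (b :: x) | j <- iota 0 (size (b :: x)).+1] =
    [::] :: map (cons b) [seq take j x | j <- iota 0 (size x).+1].
  have -> : iota 0 (size (b :: x)).+1 = 0%N :: iota (1 + 0) (size x).+1 by [].
  by rewrite iotaDl /= -!map_comp.
by case: b; rewrite /= IH ?cats0.
Qed.

Lemma size_leaves_path_tree x : size (leaves (path_tree x)) = (size x).+2.
Proof. by elim: x => [|[] x IH] //=; rewrite ?size_cat !size_map IH ?addn1. Qed.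

Lemma level_Node T1 T2 j :
  count (fun v => size v == j.+1)
    (internal (Node T1 T2) ++ leaves (Node T1 T2)) =
  (count (fun v => size v == j) (internal T1 ++ leaves T1) +
   count (fun v => size v == j) (internal T2 ++ leaves T2))%N.
Proof.
by rewrite /= !count_cat !count_map add0n addnACA.
Qed.

Lemma path_treeP T : path_tree_prop T <-> T = Leaf \/ exists x, T = path_tree x.
Proof.
have c0 S : count (fun v => size v == 0%N) (internal S ++ leaves S) = 1%N.
  by case: S => // S1 S2; rewrite /= !(count_cat, count_map) /= !count_pred0.
split.
  elim: T => [|T1 IH1 T2 IH2] pT; [by left | right].
  have p1 : path_tree_prop T1.
    by move=> j; apply: leq_trans (pT j.+1); rewrite level_Node leq_addr.
  have p2 : path_tree_prop T2.
    by move=> j; apply: leq_trans (pT j.+1); rewrite level_Node leq_addl.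
  case: (IH1 p1) => [->|[x e1]]; case: (IH2 p2) => [->|[y e2]].
  - by exists [::].
  - by exists (rgt :: y); rewrite e2.
  - by exists (lft :: x); rewrite e1.
  have c2 z : count (fun v => size v == 1%N)
      (internal (path_tree z) ++ leaves (path_tree z)) = 2%N.
    by case: z => [|[] z]; rewrite level_Node !c0.
  by have := pT 2%N; rewrite level_Node e1 e2 !c2.
case=> [->|[x ->]]; first by case=> [|j].
elim: x => [|b x IH] j; first by case: j => [|[|j]].
case: j => [|j]; first by rewrite c0.
have cL : (count (fun v => size v == j) (internal Leaf ++ leaves Leaf) +
    count (fun v => size v == j) (internal (path_tree x) ++ leaves (path_tree x))
    <= 2)%N.
  by case: j => [|j]; [rewrite !c0 | exact: IH].
by case: b; rewrite level_Node // addnC.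
Qed.

Definition LeftCombTree (n : nat) : btree := path_tree (nseq (n - 2) lft).

Definition RightCrookedTree (n : nat) : btree :=
  path_tree (word_pow [:: rgt; lft] ((n%:R - 2%:R) / 2%:R)).

(* Main.v *)
(* Identify the letters with the nonzero elements of the Klein group and let p_k
   be the sum of the first k letters of a word.  A tree parses the word iff
   p_i <> p_j whenever the leaves i+1, ..., j are those below some vertex.  For
   the left comb this says that p_1, ..., p_n are nonzero; for the right crooked
   tree, apart from p_0 <> p_n, it says that consecutive terms of the zigzag
   p_n, p_1, p_(n-1), p_2, p_(n-2), ... are distinct.  Terms at distance two in
   the zigzag are distinct because letters are nonzero.  Hence the zigzag takes
   three values, any three consecutive terms being distinct, so it is periodic
   of period 3 and unique up to a permutation of the alphabet. *)
Require Import Defs.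
From mathcomp Require Import all_boot all_order all_fingroup all_algebra.
From mathcomp Require Import boolp classical_sets.
From mathcomp Require Import zify ring.

Import Order.TTheory GRing.Theory Num.Theory.
Local Open Scope ring_scope.
Local Open Scope classical_set_scope.

(** * Rational powers of words as periodic sequences *)

Lemma word_pow_mkseq (A : Type) (x0 : A) (w : seq A) (m : nat) :
  (0 < size w)%N ->
  word_pow w (m%:R / (size w)%:R) =
  mkseq (fun i => nth x0 w (i %% size w)%N) m.
Proof.
move=> w_gt0; have s_neq0 : (size w)%:R != 0 :> rat by rewrite pnatr_eq0 -lt0n.
have trE : Num.truncn (m%:R / (size w)%:R : rat) = (m %/ size w)%N.
  apply/eqP; rewrite truncn_eq ?divr_ge0 ?ler0n //.
  rewrite ler_pdivlMr ?ltr0n // ltr_pdivrMr ?ltr0n // -!natrM ler_nat ltr_nat.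
  by rewrite leq_divM ltn_ceil.
have remE : (size w)%:R * (m%:R / (size w)%:R - (m %/ size w)%:R) =
    (m %% size w)%:R :> rat.
  rewrite mulrBr mulrCA divff // mulr1 [in m%:R](divn_eq m (size w)).
  by rewrite natrD natrM mulrC addrAC subrr add0r.
rewrite /word_pow trE remE natrK [in RHS](divn_eq m (size w)).
have := ltn_pmod m w_gt0; move: (m %% size w)%N => r r_lt.
elim: (m %/ size w)%N => [|q IH] /=.
  rewrite mul0n add0n; apply: (@eq_from_nth _ x0).
    by rewrite size_mkseq size_takel // ltnW.
  move=> i; rewrite size_takel ?(ltnW r_lt) // => i_lt.
  by rewrite nth_take // nth_mkseq // modn_small // (ltn_trans i_lt).
rewrite mulSn -addnA /mkseq iotaD map_cat -catA IH; congr (_ ++ _).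
  rewrite -[LHS](mkseq_nth x0); apply/eq_in_map => i; rewrite mem_iota add0n.
  by move=> i_lt; rewrite modn_small.
rewrite add0n -[in RHS](addn0 (size w)) iotaDl -map_comp addn0.
by apply: eq_map => i /=; rewrite modnDl.
Qed.

(** * Parsing by path trees through prefix sums in the Klein group *)

Section Derivations.

Implicit Types (T : btree) (a b c : 'I_3) (w : seq 'I_3) (x : seq bool).

(** Recursive form of parsing that exposes the root label, so that induction on the tree applies. *)
Fixpoint derives T a w : Prop :=
  if T is Node T1 T2 then
    exists b c w1 w2,
      [/\ w = w1 ++ w2, derives T1 b w1, derives T2 c w2 & (a, b, c) \in grammar]
  else w = [:: a].

Lemma parsesP T w : parses T w <-> exists a, derives T a w.
Proof.
suff labelP a : derives T a w <-> exists f, [/\ f [::] = a,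
    map f (leaves T) = w & forall v, v \in internal T ->
      (f v, f (rcons v lft), f (rcons v rgt)) \in grammar].
  split=> [[f [fw fT]]|[a /labelP[f [_ fw fT]]]]; last by exists f.
  by exists (f [::]); apply/labelP; exists f.
elim: T a w => [|T1 IH1 T2 IH2] a w /=.
  by split=> [->|[f [<- <- _]] //]; exists (fun=> a).
split=> [[b [c [w1 [w2 [-> /IH1[f [fb fw1 fT1]] /IH2[g [gc gw2 gT2]] abc]]]]]|].
  exists (fun v => if v is d :: v' then if d then g v' else f v' else a).
  split=> //; first by rewrite map_cat -!map_comp -fw1 -gw2.
  move=> v; rewrite inE mem_cat => /orP[/eqP->|/orP[]].
  - by rewrite /= fb gc.
  - by case/mapP => u /fT1 ? ->.
  - by case/mapP => u /gT2 ? ->.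
case=> f [fa fw fT]; exists (f [:: lft]), (f [:: rgt]).
exists (map (f \o cons lft) (leaves T1)), (map (f \o cons rgt) (leaves T2)).
split.
- by rewrite -fw map_cat -!map_comp.
- apply/IH1; exists (f \o cons lft); split=> // v vT1 /=.
  by apply: (fT (lft :: v)); rewrite inE mem_cat map_f.
- apply/IH2; exists (f \o cons rgt); split=> // v vT2 /=.
  by apply: (fT (rgt :: v)); rewrite inE mem_cat map_f ?orbT.
- by have := fT [::] isT; rewrite fa.
Qed.

(* The letters are the nonzero elements of the Klein group, where a -> bc is a
   rule exactly when a = b + c; so the label of a vertex is the sum of the
   leaves below it. *)
Definition klein a : bool * bool :=
  nth (0, 0) [:: (true, false); (false, true); (true, true)] a.

Definition prefix_sum w k : bool * bool := \sum_(a <- take k w) klein a.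

Lemma klein_inj : injective klein.
Proof.
by case=> [[|[|[|//]]] ?] [[|[|[|//]]] ?] //= _; apply: val_inj.
Qed.

Lemma klein_neq0 a : klein a != 0.
Proof. by case: a => [[|[|[|?]]] ?]. Qed.

Lemma kleinP (v : bool * bool) : v != 0 -> exists a, klein a = v.
Proof.
by case: v => [[] []] // _; [exists 2%:R | exists 0 | exists 1].
Qed.

Lemma addbb_pair (v : bool * bool) : v + v = 0.
Proof. by case: v => [[] []]. Qed.

Lemma grammar_klein a b c : ((a, b, c) \in grammar) = (klein a == klein b + klein c).
Proof.
by case: a b c => [[|[|[|?]]] ?] // [[|[|[|?]]] ?] // [[|[|[|?]]] ?].
Qed.

(** Since 0 + 1 + 2 = 0 mod 3, [- (a + b)] is the letter other than [a] and [b]; the three nonzero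
    Klein elements also sum to zero. *)
Lemma third_klein a b : a != b -> klein (- (a + b)) = klein a + klein b.
Proof. by case: a b => [[|[|[|?]]] ?] // [[|[|[|?]]] ?]. Qed.

Lemma prefix_sum0 w : prefix_sum w 0 = 0.
Proof. by rewrite /prefix_sum take0 big_nil. Qed.

Lemma prefix_sum_cons a w k :
  prefix_sum (a :: w) k.+1 = klein a + prefix_sum w k.
Proof. by rewrite /prefix_sum /= big_cons. Qed.

Lemma prefix_sumS w k : (k < size w)%N ->
  prefix_sum w k.+1 = prefix_sum w k + klein (nth 0 w k).
Proof. by move=> kw; rewrite /prefix_sum (take_nth 0) // big_rcons /= addrC. Qed.

Lemma prefix_sum_rcons w a k : (k <= size w)%N ->
  prefix_sum (rcons w a) k = prefix_sum w k.
Proof. by move=> kw; rewrite /prefix_sum -cats1 takel_cat. Qed.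

(** A turn to the right leaves one leaf on the left, and conversely. So the internal vertex at level
    [t] spans the leaves between the two positions compared, and it can be labeled exactly when
    their sum is nonzero. *)
Lemma derives_path_tree x a w : derives (path_tree x) a w <->
  [/\ size w = (size x).+2, klein a = prefix_sum w (size w) &
      forall t, (t <= size x)%N ->
        prefix_sum w (count id (take t x)) !=
        prefix_sum w (size w - count negb (take t x))].
Proof.
elim: x a w => [|d x IH] a w.
  split=> [/= [b [c [_ [_ [-> -> ->]]]]]|].
    rewrite grammar_klein => /eqP aE.
    have sE : klein a = prefix_sum [:: b; c] 2 by
      rewrite !prefix_sum_cons prefix_sum0 addr0.
    split=> // t _; rewrite prefix_sum0 -sE.
    by rewrite eq_sym klein_neq0.
  case: w => [|b [|c [|? ?]]] [] //= _ aE _; exists b, c, [:: b], [:: c]; split=> //.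
  by rewrite grammar_klein aE !prefix_sum_cons prefix_sum0 addr0.
case: d => /=.
- split=> [[b [c [_ [w2 [-> -> /IH[sz cE pw]]]]]]|].
    rewrite grammar_klein cE -prefix_sum_cons => /eqP aE.
    split=> //=; [by rewrite sz | case=> [_|t t_le] /=].
      by rewrite prefix_sum0 subn0 -aE eq_sym klein_neq0.
    (* The first letter shifts both positions by one and adds [klein b] to both sums, so it
       cancels. *)
    rewrite add0n add1n subSn ?prefix_sum_cons; last first.
      rewrite (leq_trans (count_size _ _)) // size_take_min sz; lia.
    by rewrite (inj_eq (addrI _)) pw.
  case: w => [|b w] [] //= [sz] aE pw.
  (* The condition at level 1 makes the sum below the right child nonzero, which yields its
     label. *)
  have [|c cE] := @kleinP (prefix_sum w (size w)).
    have := pw 1%N isT; rewrite /= take0 /= addn0 subn0 !prefix_sum_cons.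
    by rewrite (inj_eq (addrI _)) prefix_sum0 eq_sym.
  exists b, c, [:: b], w; split=> //; last first.
    by rewrite grammar_klein aE prefix_sum_cons cE.
  apply/IH; split=> // t t_le; have := pw t.+1 t_le.
  rewrite /= add0n add1n subSn ?prefix_sum_cons; last first.
    rewrite (leq_trans (count_size _ _)) // size_take_min sz; lia.
  by rewrite (inj_eq (addrI _)).
(* Here the extra leaf comes last, beyond both positions, so the prefix sums do not change. *)
- have szc t w' c : size w' = (size x).+2 -> (t <= size x)%N ->
    prefix_sum (rcons w' c) (0 + count id (take t x)) =
      prefix_sum w' (count id (take t x)) /\
    prefix_sum (rcons w' c) (size (rcons w' c) - (1 + count negb (take t x))) =
      prefix_sum w' (size w' - count negb (take t x)).
    move=> sz t_le; rewrite size_rcons add0n add1n subSS.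
    by rewrite !prefix_sum_rcons ?leq_subr // (leq_trans (count_size _ _)) //
      size_take_min sz; lia.
  split=> [[b [c [w' [_ [-> /IH[sz bE pw] ->]]]]]|].
    rewrite grammar_klein cats1 bE => /eqP aE.
    have sE : klein a = prefix_sum (rcons w' c) (size (rcons w' c)).
      rewrite size_rcons prefix_sumS ?size_rcons //.
      by rewrite prefix_sum_rcons // nth_rcons ltnn eqxx.
    split=> //; [by rewrite size_rcons sz | case=> [_|t t_le] /=].
      by rewrite prefix_sum0 subn0 -sE eq_sym klein_neq0.
    by have [-> ->] := szc t w' c sz t_le; apply: pw.
  case/lastP: w => [|w c] [] //.
  rewrite size_rcons => -[sz] aE pw.
  have [|b bE] := @kleinP (prefix_sum w (size w)).
    have := pw 1%N isT; rewrite /= take0 /= addn0 prefix_sum0 subSS subn0.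
    by rewrite prefix_sum_rcons // eq_sym.
  exists b, c, w, [:: c]; split=> //; first by rewrite cats1.
    apply/IH; split=> // t t_le; have := pw t.+1 t_le.
    by have [/= e1 e2] := szc t w c sz t_le; rewrite e1 -(size_rcons w c) e2.
  rewrite grammar_klein aE prefix_sumS ?size_rcons //.
  by rewrite prefix_sum_rcons // nth_rcons ltnn eqxx bE.
Qed.

Lemma parses_path_tree x w : parses (path_tree x) w <->
  size w = (size x).+2 /\
  forall t, (t <= size x)%N ->
    prefix_sum w (count id (take t x)) !=
    prefix_sum w (size w - count negb (take t x)).
Proof.
split=> [/parsesP[a /derives_path_tree[]] //|[sz pw]].
have [|a aE] := @kleinP (prefix_sum w (size w)).
  by have := pw 0%N isT; rewrite take0 prefix_sum0 subn0 eq_sym.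
by apply/parsesP; exists a; apply/derives_path_tree.
Qed.

(** The internal vertex at level [t] spans the first [n - t] leaves. *)
Lemma parses_LeftCombTree n w : (2 <= n)%N -> parses (LeftCombTree n) w <->
  size w = n /\ forall k, (2 <= k <= n)%N -> prefix_sum w k != 0.
Proof.
move=> n_ge2; have nE : (n - 2).+2 = n by lia.
have cE t : (t <= n - 2)%N -> count id (take t (nseq (n - 2) lft)) = 0%N /\
    count negb (take t (nseq (n - 2) lft)) = t.
  by move=> t_le; rewrite take_nseq // !count_nseq mul1n.
rewrite parses_path_tree size_nseq nE; split=> -[sz pw]; split=> //.
  move=> k k_le; have t_le : (n - k <= n - 2)%N by lia.
  have [c0 c1] := cE _ t_le.
  have := pw _ t_le; rewrite c0 c1 sz prefix_sum0 eq_sym.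
  by have -> : (n - (n - k) = k)%N by lia.
move=> t t_le; have [-> ->] := cE _ t_le.
by rewrite sz prefix_sum0 eq_sym; apply: pw; lia.
Qed.

(** Of the first [t] turns of rlrl..., [uphalf t] go right and [t./2] go left. *)
Lemma parses_RightCrookedTree n w :
  (2 <= n)%N -> parses (RightCrookedTree n) w <->
  size w = n /\ forall t, (t <= n - 2)%N ->
    prefix_sum w (uphalf t) != prefix_sum w (n - t./2).
Proof.
move=> n_ge2; have nE : (n - 2).+2 = n by lia.
rewrite /RightCrookedTree -natrB // (@word_pow_mkseq _ lft) //.
set x := mkseq _ _.
have cE t : (t <= n - 2)%N ->
    count id (take t x) = uphalf t /\ count negb (take t x) = t./2.
  move=> t_le; rewrite -map_take take_iota (minn_idPl t_le) !count_map.
  elim: t {t_le} => [//|t [IH1 IH2]].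
  rewrite -addn1 iotaD !count_cat IH1 IH2.
  by rewrite /= add0n modn2 !addn0; case: (boolP (odd t)) => /= ?; lia.
rewrite parses_path_tree size_mkseq nE; split=> -[sz pw]; split=> // t t_le.
  by have := pw t t_le; have [-> ->] := cE t t_le; rewrite sz.
by have [-> ->] := cE t t_le; rewrite sz; apply: pw.
Qed.

End Derivations.

(** * Letters modulo 3 and three-valued periodic sequences *)

Section ThreeLetters.

Implicit Types (a b c : 'I_3) (s : 'I_3 -> 'I_3).

Lemma natr3_eq (i j : nat) : (i%:R == j%:R :> 'I_3) = (i == j %[mod 3]).
Proof. by rewrite !Zp_nat -val_eqE. Qed.

Lemma third_natr (i j : nat) : - (i%:R + j%:R) = (2 * (i + j))%:R :> 'I_3.
Proof.
apply/eqP; rewrite -natrD eq_sym -addr_eq0 -natrD (natr3_eq _ 0); lia.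
Qed.

Lemma third_eq a b c : uniq [:: a; b; c] -> c = - (a + b).
Proof.
case: a b c => [[|[|[|?]]] ?] // [[|[|[|?]]] ?] // [[|[|[|?]]] ?] // _;
  exact: val_inj.
Qed.

Lemma third_uniq a b : a != b -> uniq [:: a; b; - (a + b)].
Proof. by case: a b => [[|[|[|?]]] ?] // [[|[|[|?]]] ?]. Qed.

Lemma third_inj s a b : injective s -> a != b -> s (- (a + b)) = - (s a + s b).
Proof.
move=> s_inj ab; apply: third_eq.
by rewrite -[uniq _]/(uniq (map s [:: a; b; - (a + b)])) map_inj_uniq ?third_uniq.
Qed.

Lemma three_periodic (q : nat -> 'I_3) (m : nat) : (0 < m)%N ->
  (forall t, (t < m)%N -> q t != q t.+1) ->
  (forall t, (t.+1 < m)%N -> q t != q t.+2) ->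
  exists s : {perm 'I_3}, forall t, (t <= m)%N -> q t = s t%:R.
Proof.
move=> m_gt0 q1 q2.
(* The image of 2 is the third letter rather than [q 2], which is unconstrained when [m] is 1. *)
pose s (i : 'I_3) := nth 0 [:: q 0%N; q 1%N; - (q 0%N + q 1%N)] i.
have s_inj : injective s.
  move=> i j /eqP; rewrite /s nth_uniq ?third_uniq ?q1 //.
  by move/eqP/val_inj.
exists (perm s_inj).
(* Each term is determined by the two before it, so the induction carries two consecutive terms. *)
suff H t : (t <= m)%N ->
    q t = s t%:R /\ ((t < m)%N -> q t.+1 = s t.+1%:R).
  by move=> t /H[]; rewrite permE.
elim: t => [//|t IH] t_lt; have [qt qSt] := IH (ltnW t_lt).
have {}qSt := qSt t_lt; split=> // St_lt.
rewrite (@third_eq (q t) (q t.+1) (q t.+2)); last first.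
  by rewrite /= !inE !negb_or !q1 ?q2.
rewrite qt qSt -third_inj //; last by rewrite natr3_eq; lia.
by congr s; apply/eqP; rewrite third_natr natr3_eq; lia.
Qed.

Lemma klein_third s a b : injective s -> a != b ->
  klein (s (- (a + b))) = klein (s a) + klein (s b).
Proof.
by move=> s_inj ab; rewrite third_inj // third_klein // (inj_eq s_inj).
Qed.

End ThreeLetters.

(** * The zigzag of positions and the unique common class *)

Section Zigzag.

Implicit Types (n k t : nat) (w : seq 'I_3).

(* The intervals of leaves below the internal vertices of RightCrookedTree(n)
   other than the root have endpoints (as positions between letters) zigzag t
   and zigzag t.+1. *)
Definition zigzag n t := if odd t then uphalf t else (n - t./2)%N.

(** Index at which position [k] occurs in the zigzag, for [k] from 1 to [n]: the lower half occupies
    odd indices, the upper half even ones. *)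
Definition zigzag_inv n k := if (k.*2 <= n)%N then k.*2.-1 else (n - k).*2.

(** The letter leading from p_k to p_(k+1) is their Klein sum, hence the third letter -(i + j) = 2(i
    + j) mod 3 of their zigzag indices. The first letter is p_1, which has index 1. *)
Definition letter n k : nat :=
  if k is 0 then 1 else (2 * (zigzag_inv n k + zigzag_inv n k.+1))%N.

Definition canonical_word n : seq 'I_3 := mkseq (fun k => (letter n k)%:R) n.

Lemma zigzag_invK n k : (0 < k <= n)%N ->
  zigzag n (zigzag_inv n k) = k /\ (zigzag_inv n k < n)%N.
Proof. rewrite /zigzag /zigzag_inv; do 2?case: ifP; lia. Qed.

Lemma zigzagK n t : (t < n)%N ->
  zigzag_inv n (zigzag n t) = t /\ (0 < zigzag n t <= n)%N.
Proof. rewrite /zigzag /zigzag_inv; do 2?case: ifP; lia. Qed.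

(** Neighbouring positions have indices at distance 2, or 1 at the middle. *)
Lemma zigzag_invS_neq n k : (0 < k < n)%N ->
  (zigzag_inv n k)%:R != (zigzag_inv n k.+1)%:R :> 'I_3.
Proof. rewrite natr3_eq /zigzag_inv; do 2?case: ifP; lia. Qed.

Lemma klein_letter n k (s : 'I_3 -> 'I_3) : injective s -> (0 < k < n)%N ->
  klein (s (letter n k)%:R) =
  klein (s (zigzag_inv n k)%:R) + klein (s (zigzag_inv n k.+1)%:R).
Proof.
case: k => // k s_inj kn; rewrite -klein_third ?zigzag_invS_neq //.
by rewrite third_natr.
Qed.

Lemma prefix_sum_canonical n k (s : 'I_3 -> 'I_3) :
  (2 <= n)%N -> injective s -> (0 < k <= n)%N ->
  prefix_sum (map s (canonical_word n)) k = klein (s (zigzag_inv n k)%:R).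
Proof.
move=> n_ge2 s_inj; elim: k => // k IH kn.
rewrite prefix_sumS ?size_map ?size_iota; last by case/andP: kn.
rewrite (nth_map 0) ?size_mkseq ?nth_mkseq; [|by case/andP: kn..].
case: k => [|k] in IH kn *.
  by rewrite prefix_sum0 add0r /zigzag_inv n_ge2.
by rewrite IH ?klein_letter //; [rewrite addrA addbb_pair add0r | lia].
Qed.

Lemma parses_canonical n (s : 'I_3 -> 'I_3) : (2 <= n)%N -> injective s ->
  parses (LeftCombTree n) (map s (canonical_word n)) /\
  parses (RightCrookedTree n) (map s (canonical_word n)).
Proof.
move=> n_ge2 s_inj; have sz : size (map s (canonical_word n)) = n.
  by rewrite size_map size_mkseq.
split; [apply/parses_LeftCombTree | apply/parses_RightCrookedTree] => //.
  by split=> // k kn; rewrite prefix_sum_canonical ?klein_neq0 //; lia.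
split=> // [[|t]] t_le.
  rewrite prefix_sum0 prefix_sum_canonical // 1?eq_sym ?klein_neq0 //; lia.
(* The two positions have consecutive zigzag indices. *)
rewrite !prefix_sum_canonical //; [|lia..].
rewrite (inj_eq klein_inj) (inj_eq s_inj) natr3_eq /zigzag_inv; do 2?case: ifP; lia.
Qed.

Lemma parses_both_canonical n w : (2 <= n)%N ->
  parses (LeftCombTree n) w -> parses (RightCrookedTree n) w ->
  exists s : {perm 'I_3}, w = map s (canonical_word n).
Proof.
move=> n_ge2 /parses_LeftCombTree[//|sz pL] /parses_RightCrookedTree[//|_ pR].
have p_neq k : (k < n)%N -> prefix_sum w k != prefix_sum w k.+1.
  move=> kn; rewrite prefix_sumS ?sz // -subr_eq0 opprD addrA subrr add0r.
  by rewrite oppr_eq0 klein_neq0.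
have p_neq0 k : (0 < k <= n)%N -> prefix_sum w k != 0.
  case: k => // -[_|k kn]; last exact: pL.
  by have := p_neq 0%N; rewrite prefix_sum0 eq_sym; apply; lia.
have /choice[c cE] : forall k, exists a,
    (0 < k <= n)%N -> klein a = prefix_sum w k.
  move=> k; case: (boolP (0 < k <= n)%N) => [kn|_]; last by exists 0.
  by have [a aE] := kleinP _ (p_neq0 _ kn); exists a.
have q_neq t u : (t < n)%N -> (u < n)%N ->
    prefix_sum w (zigzag n t) != prefix_sum w (zigzag n u) ->
    c (zigzag n t) != c (zigzag n u).
  move=> /zigzagK[_ tn] /zigzagK[_ un]; apply: contra => /eqP tu.
  by rewrite -!cE // tu.
have p_adj i j : (i <= n)%N -> (j <= n)%N -> i.+1 = j \/ j.+1 = i ->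
    prefix_sum w i != prefix_sum w j.
  by move=> ? ? [] ij; [|rewrite eq_sym]; rewrite -ij p_neq ?ij.
have [||t tn|s sE] := @three_periodic (fun t => c (zigzag n t)) n.-1; first lia.
- move=> t tn; apply: q_neq; [lia..|].
  (* The last two zigzag terms are neighbouring positions, so they differ because a letter is
     nonzero; the crooked tree gives the earlier pairs. *)
  have [t_lt|t_ge] := ltnP t.+1 n.-1; last first.
    by apply: p_adj; rewrite /zigzag /=; do 2?case: ifP => /=; lia.
  have /pR : (t.+1 <= n - 2)%N by lia.
  rewrite /zigzag /=; case: (boolP (odd t)) => t_odd /=; last rewrite eq_sym.
    by have -> : (t./2).+1 = uphalf t by lia.
  by have -> : uphalf t = t./2 by lia.
- by apply: q_neq; [lia..|apply: p_adj; rewrite /zigzag /=; do 2?case: ifP => /=; lia].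
have pE k : (0 < k <= n)%N -> prefix_sum w k = klein (s (zigzag_inv n k)%:R).
  move=> kn; have [zK z_lt] := zigzag_invK _ _ kn.
  by rewrite -sE ?zK ?cE //; lia.
exists s; apply: (@eq_from_nth _ 0) => [|k]; first by rewrite size_map size_mkseq.
rewrite sz => kn; rewrite (nth_map 0) ?size_mkseq ?nth_mkseq //.
apply: klein_inj; have := prefix_sumS w k; rewrite sz => /(_ kn).
case: k kn => [|k] kn.
  by rewrite prefix_sum0 add0r pE // /zigzag_inv n_ge2.
rewrite klein_letter ?pE //; try lia; last exact: perm_inj.
by move=> ->; rewrite addrA addbb_pair add0r.
Qed.

Lemma word_class_map w (s : {perm 'I_3}) : word_class (map s w) = word_class w.
Proof.
apply/seteqP; split=> _ [u ->]; [exists (s * u)%g | exists (s^-1 * u)%g];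
  rewrite -?map_comp; apply: eq_map => i /=; rewrite !permM ?permK //.
Qed.

Lemma ParseWords_canonical n : (2 <= n)%N ->
  ParseWords (LeftCombTree n) (RightCrookedTree n) =
  [set word_class (canonical_word n)].
Proof.
move=> n_ge2; apply/seteqP; split=> [_ [w [wL wR ->]]|_ ->] /=.
  by have [s ->] := parses_both_canonical n w n_ge2 wL wR; rewrite word_class_map.
exists (canonical_word n); rewrite -{1 2}(map_id (canonical_word n)).
by have [] := @parses_canonical n id n_ge2 (@inj_id _).
Qed.

(** * The closed form of the common word *)

Lemma mod3E (i : int) (j : nat) : (i = j%:Z %[mod 3])%Z -> mod3 i = j%:R.
Proof.
move=> ij; apply: val_inj; rewrite Zp_nat /mod3 ij modz_nat absz_nat.
by rewrite /= inordK ?ltn_pmod.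
Qed.

Lemma word_pow_w012 (m : nat) :
  word_pow w012 (m%:R / 3%:R) = mkseq (fun i => i%:R) m.
Proof.
rewrite (word_pow_mkseq _ 0 w012 m isT); apply: eq_mkseq => i.
apply: val_inj; rewrite Zp_nat /=.
by have := ltn_pmod i (isT : 0 < 3)%N; move: (i %% 3)%N => [|[|[|]]].
Qed.

(** After its first letter, the canonical word descends by one mod 3 for [a] letters and then
    ascends for [b] letters. *)
Lemma word_class_canonical n a b : n = (a + b).+1 ->
  (a == n./2) && ~~ odd n || (a.+1 == n./2) && odd n ->
  word_class ([:: mod3 (1 - n%:Z)] ++ rev (word_pow w012 (a%:R / 3%:R))
    ++ word_pow w012 (b%:R / 3%:R)) = word_class (canonical_word n).
Proof.
move=> nE aE.
(* Adding 2n, which is -n mod 3, to every letter turns the first letter 1 into 1 - n. *)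
rewrite -(word_class_map (canonical_word n) (perm (addIr (2 * n)%:R))).
congr word_class; rewrite !word_pow_w012; apply: (@eq_from_nth _ 0).
  by rewrite /= size_cat size_rev !size_map !size_iota nE.
move=> k; rewrite /= size_cat size_rev !size_mkseq -nE => kn.
rewrite (nth_map 0) ?size_mkseq // nth_mkseq // permE -natrD.
case: k kn => [|k] kn /=.
  by apply: mod3E; lia.
rewrite nth_cat size_rev size_mkseq; case: ltnP => ka.
  rewrite nth_rev ?size_mkseq // nth_mkseq; last lia.
  apply/eqP; rewrite natr3_eq /zigzag_inv; do 2?case: ifP; lia.
rewrite nth_mkseq; last lia.
apply/eqP; rewrite natr3_eq /zigzag_inv; do 2?case: ifP; lia.
Qed.

End Zigzag.

Theorem theorem6 (n : nat) (n_ge2 : (2 <= n)%N) :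
  (~~ odd n ->
    ParseWords (LeftCombTree n) (RightCrookedTree n) =
    [set word_class
      ([:: mod3 (1 - n%:Z)] ++ rev (word_pow w012 (n%:R / 6%:R))
        ++ word_pow w012 ((n%:R - 2%:R) / 6%:R))]) /\
  (odd n ->
    ParseWords (LeftCombTree n) (RightCrookedTree n) =
    [set word_class
      ([:: mod3 (1 - n%:Z)] ++ rev (word_pow w012 ((n%:R - 3%:R) / 6%:R))
        ++ word_pow w012 ((n%:R + 1) / 6%:R))]).
Proof.
split=> n_odd; rewrite ParseWords_canonical //.
(* Here a = n/2 and b = n/2 - 1, so the exponents are a/3 and b/3. *)
- have n2 : n%:R = 2%:R * (n./2.-1)%:R + 2%:R :> rat.
    by rewrite -natrM -natrD; congr _%:R; lia.
  rewrite -(word_class_canonical n n./2 n./2.-1); [|lia..].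
  congr [set word_class (_ ++ rev (word_pow _ _) ++ word_pow _ _)].
    by rewrite -[in n./2](prednK (n := n./2)) ?n2 -?natr1; [field | lia].
  by rewrite n2; field.
(* Here a = (n - 3)/2 and b = (n + 1)/2. *)
- have n2 : n%:R = 2%:R * (n./2.-1)%:R + 3%:R :> rat.
    by rewrite -natrM -natrD; congr _%:R; lia.
  rewrite -(word_class_canonical n n./2.-1 n./2.+1); [|lia..].
  congr [set word_class (_ ++ rev (word_pow _ _) ++ word_pow _ _)].
    by rewrite n2; field.
  have -> : n./2.+1 = (n./2.-1 + 2)%N by lia.
  by rewrite n2 natrD; field.
Qed.
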